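(* Let $H=\mathcal{K}\,\triangleright\!\!\!\blacktriangleleft\mathcal{L}$ be a bicrossproduct Hopf algebra over $\mathbb{C}$ with $\mathcal{K}$ cocommutative and $\mathcal{L}$ commutative, with generators $k_1,\dots,k_r$ of $\mathcal{K}$ and $l_1,\dots,l_s$ of $\mathcal{L}$ and dual generators $\kappa_1,\dots,\kappa_r$, $\lambda_1,\dots,\lambda_s$ as described in the context. Let $a\in\mathbb{R}^s$ and consider the representation of $H$ induced by the character $1\dashv l_n=a_1^{n_1}\cdots a_s^{n_s}$ ($n\in\mathbb{N}^s$) of $\mathcal{L}$, realized on $\mathcal{K}^*$ through the isomorphism $\mathcal{K}^*\to\mathbb{C}^\uparrow$, $\kappa\mapsto\kappa\psi$, with $\psi=e^{a_1\lambda_1}\cdots e^{a_s\lambda_s}$. Then the explicit action of the generators of $\mathcal{K}$ and $\mathcal{L}$ is $$\kappa\dashv k_i=\kappa\prec k_i,\qquad \kappa\dashv l_j=\kappa\;\,\tilde l_j\circ\Phi_{(\kappa_1,\kappa_2,\dots,\kappa_r)}(a),\qquad i\in\{1,\dots,r\},\ j\in\{1,\dots,s\},$$ where $\prec$ denotes the regular action of $\mathcal{K}$ on $\mathcal{K}^*$, $\langle k,\kappa\prec k'\rangle=\langle k'k,\kappa\rangle$, and $\Phi_{(\kappa_1,\kappa_2,\dots,\kappa_r)}=\Phi_r^{\kappa_r}\circ\cdots\circ\Phi_2^{\kappa_2}\circ\Phi_1^{\kappa_1}$, with $\Phi_i$ the flow of the vector field $X_i$ on $\mathbb{R}^s$ induced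 by $k_i$.
   Context: Bicrossproduct: $\mathcal{L}$ is a right $\mathcal{K}$-module algebra (action $\triangleleft$) and $\mathcal{K}$ a left $\mathcal{L}$-comodule coalgebra (coaction $k\mapsto k^{(1)}\otimes k^{(2)}\in\mathcal{L}\otimes\mathcal{K}$), with the usual compatibility conditions making $H=\mathcal{K}\otimes\mathcal{L}$ (write $kl=k\otimes l$) a Hopf algebra with product $(k\otimes l)(k'\otimes l')=kk'_{(1)}\otimes(l\triangleleft k'_{(2)})l'$ and coproduct $\Delta(k\otimes l)=k_{(1)}\otimes{k_{(2)}}^{(1)}l_{(1)}\otimes{k_{(2)}}^{(2)}\otimes l_{(2)}$. Multi-index notation: $k_m=k_1^{m_1}\cdots k_r^{m_r}$, $l_n=l_1^{n_1}\cdots l_s^{n_s}$, $\kappa^m=\kappa_1^{m_1}\cdots\kappa_r^{m_r}$, $\lambda^n=\lambda_1^{n_1}\cdots\lambda_s^{n_s}$, $m!=\prod_i m_i!$; $\mathbb{N}$ contains $0$. Standing assumptions: $\mathcal{K}$ is generated by primitive elements $k_1,\dots,k_r$, $\mathcal{L}$ is generated by $l_1,\dots,l_s$; $(k_m)_{m\in\mathbb{N}^r}$ and $(l_n)_{n\in\mathbb{N}^s}$ are vector space bases of $\mathcal{K}$ and $\mathcal{L}$. The duals $\mathcal{K}^*$, $\mathcal{L}^*$ have generators $\kappa_1,\dots,\kappa_r$ and $\lambda_1,\dots,\lambda_s$ whose ordered monomials are bases, with $\langle k_ml_n,\kappa^{m'}\lambda^{n'}\rangle=m!\,n!\,\delta_m^{m'}\delta_n^{n'}$.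 Since $\mathcal{K}$ is cocommutative, $\mathcal{K}^*$ is commutative. Functionals on $H$ (resp. $\mathcal{K}$) are identified with formal series in $\kappa^m\lambda^n$ (resp. $\kappa^m$). Induced representation: $\mathbb{C}^\uparrow$ is the space of functionals $f$ on $H$ with $f(hl)=f(h)\dashv l$ (i.e. $f(h)$ times the value of the character at $l$) for $h\in H$, $l\in\mathcal{L}$, with right action $\langle f\dashv h,h'\rangle=\langle f,hh'\rangle$. Its elements are the $\kappa\psi$, $\kappa\in\mathcal{K}^*$, and $\kappa\dashv h$ denotes the element of $\mathcal{K}^*$ with $(\kappa\psi)\dashv h=(\kappa\dashv h)\psi$. Vector fields and flows: $\mathcal{L}$ is identified with functions on $\mathbb{R}^s$ through the algebra morphism $l\mapsto\tilde l$ with $\tilde l_j(x)=x_j$. As the $k_i$ are primitive they act on $\mathcal{L}$ by derivations, hence induce vector fields $X_i$ on $\mathbb{R}^s$ by $X_i\tilde l=\widetilde{l\triangleleft k_i}$. The (in general not globally defined) flow $\Phi_i:\mathbb{R}\times\mathbb{R}^s\to\mathbb{R}^s$ of $X_i$ is determined by $(X_if)(x)=\frac{d}{dt}\big|_{t=0}f(\Phi_i^t(x))$. The expression $\tilde l_j\circ\Phi_{(\kappa_1,\dots,\kappa_r)}(a)\in\mathcal{K}^*$ is obtained by formally replacing the real numbers $t_i$ by $\kappa_i$ in (the Taylor expansion at $t=0$ of) $\tilde l_j(\Phi_{(t_1,\dots,t_r)}(a))$, where $\Phi_{(t_1,\dots,t_r)}=\Phi_r^{t_r}\circ\cdots\circ\Phi_2^{t_2}\circ\Phi_1^{t_1}$;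 juxtaposition with $\kappa$ is the product in $\mathcal{K}^*$.
   Formalization: The printed order of composition is false when the k_i act non-commutingly; the formula for κ⊣l_j is proved with Φ_1^{κ_1}∘…∘Φ_r^{κ_r} in general, and with the printed Φ_r^{κ_r}∘…∘Φ_1^{κ_1} when the actions of the k_i on L commute. *)

(* Defs.v *)
From HB Require Import structures.
From mathcomp Require Import all_boot all_order all_algebra.
From mathcomp Require Import all_classical all_reals all_analysis.
From mathcomp.real_closed Require Import complex.

Set Implicit Arguments.
Unset Strict Implicit.
Unset Printing Implicit Defensive.

Import Order.TTheory GRing.Theory Num.Theory numFieldNormedType.Exports.

Local Open Scope ring_scope.
Local Open Scope classical_set_scope.
Local Open Scope complex_scope.
Local Open Scope quotient_scope.

Reserved Notation "x ⊗ y" (at level 45, left associativity).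
Reserved Notation "\swd_ ( x , y <- t ) E"
  (at level 41, E at level 41, x binder, y binder,
   format "'[' \swd_ ( x ,  y  <-  t ) '/  '  E ']'").

(* The tensor product V (x) W: finite lists of pairs, two lists being
   identified when no bilinear map separates the corresponding sums. *)
Section Tensor.
Variables (F : fieldType) (V W : lmodType F).

Definition bilinear_map (Z : lmodType F) (B : V -> W -> Z) : Prop :=
  (forall w, linear (B^~ w)) /\ (forall v, linear (B v)).

Definition tsum (Z : lmodType F) (B : V -> W -> Z) (s : seq (V * W)) : Z :=
  \sum_(p <- s) B p.1 p.2.

Definition teq (s t : seq (V * W)) : bool :=
  `[< forall (Z : lmodType F) (B : V -> W -> Z),
        bilinear_map B -> tsum B s = tsum B t >].

Lemma teq_refl : reflexive teq.
Proof. by move=> s; apply/asboolP. Qed.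

Lemma teq_sym : symmetric teq.
Proof.
by move=> s t; apply/asboolP/asboolP => st Z B bB; rewrite (st Z B bB).
Qed.

Lemma teq_trans : transitive teq.
Proof.
move=> t s u /asboolP st /asboolP tu; apply/asboolP => Z B bB.
by rewrite (st Z B bB) (tu Z B bB).
Qed.

Canonical teq_equiv := EquivRel teq teq_refl teq_sym teq_trans.

Definition tensor : Type := {eq_quot teq}.

HB.instance Definition _ := Choice.on tensor.
HB.instance Definition _ := EqQuotient.on tensor.

Definition tscale_seq (c : F) (s : seq (V * W)) : seq (V * W) :=
  [seq (c *: p.1, p.2) | p <- s].

Definition tens (v : V) (w : W) : tensor := \pi_tensor [:: (v, w)].
Definition tzero : tensor := \pi_tensor [::].
Definition tadd (x y : tensor) : tensor := \pi_tensor (repr x ++ repr y).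
Definition tscale (c : F) (x : tensor) : tensor :=
  \pi_tensor (tscale_seq c (repr x)).
Definition topp (x : tensor) : tensor := tscale (-1) x.

(* For B bilinear, the linear map on V (x) W induced by B; in Sweedler
   notation, sum B(x_(1), x_(2)) for the tensor sum x_(1) (x) x_(2). *)
Definition tlift (Z : lmodType F) (B : V -> W -> Z) (x : tensor) : Z :=
  tsum B (repr x).

Lemma tensorP (x y : tensor) :
  (forall (Z : lmodType F) (B : V -> W -> Z), bilinear_map B ->
     tlift B x = tlift B y) -> x = y.
Proof.
move=> xy; rewrite -(reprK x) -(reprK y); apply/eqmodP/asboolP => Z B bB.
exact: xy.
Qed.

Lemma tlift_pi (Z : lmodType F) (B : V -> W -> Z) s :
  bilinear_map B -> tlift B (\pi_tensor s) = tsum B s.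
Proof.
move=> bB; have /eqmodP/asboolP : repr (\pi_tensor s) = s %[mod tensor].
  by rewrite reprK.
exact.
Qed.

Lemma tsum_cat (Z : lmodType F) (B : V -> W -> Z) s t :
  tsum B (s ++ t) = tsum B s + tsum B t.
Proof. exact: big_cat. Qed.

Lemma tsum_scale (Z : lmodType F) (B : V -> W -> Z) c s :
  bilinear_map B -> tsum B (tscale_seq c s) = c *: tsum B s.
Proof.
case=> Bl _; rewrite /tsum big_map scaler_sumr; apply: eq_bigr => p _ /=.
pose b := GRing.isLinear.Build _ _ _ _ (B^~ p.2) (Bl p.2).
pose f : {linear V -> Z} := HB.pack (B^~ p.2) b.
exact: (linearZ_LR f).
Qed.

Lemma tlift_tens (Z : lmodType F) (B : V -> W -> Z) v w :
  bilinear_map B -> tlift B (tens v w) = B v w.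
Proof. by move=> bB; rewrite tlift_pi// /tsum big_seq1. Qed.

Lemma tlift_zero (Z : lmodType F) (B : V -> W -> Z) :
  bilinear_map B -> tlift B tzero = 0.
Proof. by move=> bB; rewrite tlift_pi// /tsum big_nil. Qed.

Lemma tlift_add (Z : lmodType F) (B : V -> W -> Z) x y :
  bilinear_map B -> tlift B (tadd x y) = tlift B x + tlift B y.
Proof. by move=> bB; rewrite tlift_pi// tsum_cat. Qed.

Lemma tlift_scale (Z : lmodType F) (B : V -> W -> Z) c x :
  bilinear_map B -> tlift B (tscale c x) = c *: tlift B x.
Proof. by move=> bB; rewrite tlift_pi// tsum_scale. Qed.

Lemma taddA : associative tadd.
Proof. by move=> x y z; apply: tensorP => Z B bB; rewrite !tlift_add// addrA. Qed.

Lemma taddC : commutative tadd.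
Proof. by move=> x y; apply: tensorP => Z B bB; rewrite !tlift_add// addrC. Qed.

Lemma tadd0 : left_id tzero tadd.
Proof.
by move=> x; apply: tensorP => Z B bB; rewrite tlift_add// tlift_zero// add0r.
Qed.

Lemma taddN : left_inverse tzero topp tadd.
Proof.
move=> x; apply: tensorP => Z B bB.
by rewrite tlift_add// tlift_zero// tlift_scale// scaleN1r addNr.
Qed.

HB.instance Definition _ := GRing.isZmodule.Build tensor taddA taddC tadd0 taddN.

Lemma tscaleA a b x : tscale a (tscale b x) = tscale (a * b) x.
Proof. by apply: tensorP => Z B bB; rewrite !tlift_scale// scalerA. Qed.

Lemma tscale1 : left_id 1 tscale.
Proof. by move=> x; apply: tensorP => Z B bB; rewrite tlift_scale// scale1r. Qed.

Lemma tscaleDr : right_distributive tscale +%R.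
Proof.
move=> c x y; apply: tensorP => Z B bB.
by rewrite !(tlift_scale, tlift_add)// scalerDr.
Qed.

Lemma tscaleDl x : {morph tscale^~ x : a b / a + b}.
Proof.
move=> a b; apply: tensorP => Z B bB.
by rewrite !(tlift_scale, tlift_add)// scalerDl.
Qed.

HB.instance Definition _ :=
  GRing.Zmodule_isLmodule.Build F tensor tscaleA tscale1 tscaleDr tscaleDl.

End Tensor.

Arguments tensor {F} V W.

Notation "x ⊗ y" := (tens x y) : ring_scope.
Notation "\swd_ ( x , y <- t ) E" := (tlift (fun x y => E) t) : ring_scope.

Section HopfAlgebras.
Variable F : fieldType.

Record hopf_data (A : algType F) := HopfData {
  cop : {linear A -> tensor A A};
  cou : {linear A -> F^o};
  antipode : {linear A -> A} }.

Record is_hopf (A : algType F) (D : hopf_data A) : Prop := {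
  cop_coassoc : forall a,
    \swd_(x, y <- cop D a) \swd_(x1, x2 <- cop D x) (x1 ⊗ (x2 ⊗ y)) =
    \swd_(x, y <- cop D a) \swd_(y1, y2 <- cop D y) (x ⊗ (y1 ⊗ y2));
  cou_left : forall a, \swd_(x, y <- cop D a) (cou D x *: y) = a;
  cou_right : forall a, \swd_(x, y <- cop D a) (cou D y *: x) = a;
  cop1 : cop D 1 = 1 ⊗ 1;
  copM : forall a b, cop D (a * b) =
    \swd_(a1, a2 <- cop D a) \swd_(b1, b2 <- cop D b) ((a1 * b1) ⊗ (a2 * b2));
  cou1 : cou D 1 = 1;
  couM : forall a b, cou D (a * b) = cou D a * cou D b;
  antipode_left : forall a,
    \swd_(x, y <- cop D a) (antipode D x * y) = cou D a *: 1;
  antipode_right : forall a,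
    \swd_(x, y <- cop D a) (x * antipode D y) = cou D a *: 1 }.

Definition cocommutative (A : algType F) (D : hopf_data A) : Prop :=
  forall a, \swd_(x, y <- cop D a) (y ⊗ x) = cop D a.

Definition primitive (A : algType F) (D : hopf_data A) (a : A) : Prop :=
  cop D a = a ⊗ 1 + 1 ⊗ a.

End HopfAlgebras.

Section Bicrossproduct.
Variables (F : fieldType) (K : algType F) (L : comAlgType F).
Variables (HK : hopf_data K) (HL : hopf_data L).
Variables (act : L -> K -> L) (coact : {linear K -> tensor L K}).

Local Notation "l ◁ k" := (act l k) (at level 39, left associativity).
Local Notation "'ΔK'" := (cop HK).
Local Notation "'ΔL'" := (cop HL).
Local Notation "'εK'" := (cou HK).
Local Notation "'εL'" := (cou HL).

Record is_module_algebra : Prop := {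
  act_bilinear : bilinear_map act;
  act1 : forall l, l ◁ 1 = l;
  actM : forall l k k', l ◁ (k * k') = l ◁ k ◁ k';
  act_unit : forall k, 1 ◁ k = εK k *: 1;
  act_mul : forall l l' k,
    (l * l') ◁ k = \swd_(k1, k2 <- ΔK k) ((l ◁ k1) * (l' ◁ k2)) }.

Record is_comodule_coalgebra : Prop := {
  coact_coassoc : forall k,
    \swd_(u, k' <- coact k) \swd_(u1, u2 <- ΔL u) (u1 ⊗ (u2 ⊗ k')) =
    \swd_(u, k' <- coact k) \swd_(v, k'' <- coact k') (u ⊗ (v ⊗ k''));
  coact_cou : forall k, \swd_(u, k' <- coact k) (εL u *: k') = k;
  coact_cop : forall k,
    \swd_(u, k' <- coact k) \swd_(x, y <- ΔK k') (u ⊗ (x ⊗ y)) =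
    \swd_(k1, k2 <- ΔK k) \swd_(u1, x <- coact k1) \swd_(u2, y <- coact k2)
      ((u1 * u2) ⊗ (x ⊗ y));
  coact_couK : forall k, \swd_(u, k' <- coact k) (εK k' *: u) = εK k *: 1 }.

(* Majid's conditions for the bicrossproduct, for a right action and a left
   coaction. *)
Record is_compatible : Prop := {
  cou_act : forall l k, εL (l ◁ k) = εL l * εK k;
  cop_act : forall l k, ΔL (l ◁ k) =
    \swd_(l1, l2 <- ΔL l) \swd_(k1, k2 <- ΔK k) \swd_(u, k2' <- coact k2)
      (((l1 ◁ k1) * u) ⊗ (l2 ◁ k2'));
  coact1 : coact 1 = 1 ⊗ 1;
  coactM : forall k k', coact (k * k') =
    \swd_(u, x <- coact k) \swd_(k1, k2 <- ΔK k') \swd_(v, y <- coact k2)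
      (((u ◁ k1) * v) ⊗ (x * y));
  coact_act : forall l k,
    \swd_(k1, k2 <- ΔK k) \swd_(u, x <- coact k1) ((u * (l ◁ k2)) ⊗ x) =
    \swd_(k1, k2 <- ΔK k) \swd_(u, x <- coact k2) (((l ◁ k1) * u) ⊗ x) }.

Record is_bicrossproduct : Prop := {
  bicross_hopfK : is_hopf HK;
  bicross_hopfL : is_hopf HL;
  bicross_act : is_module_algebra;
  bicross_coact : is_comodule_coalgebra;
  bicross_compat : is_compatible }.

Definition bmul (h h' : tensor K L) : tensor K L :=
  \swd_(k, l <- h) \swd_(k', l' <- h') \swd_(k1', k2' <- ΔK k')
    ((k * k1') ⊗ ((l ◁ k2') * l')).

Definition bcop (h : tensor K L) : tensor (tensor K L) (tensor K L) :=
  \swd_(k, l <- h) \swd_(k1, k2 <- ΔK k) \swd_(u, k2' <- coact k2)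
  \swd_(l1, l2 <- ΔL l) ((k1 ⊗ (u * l1)) ⊗ (k2' ⊗ l2)).

Definition bcou (h : tensor K L) : F :=
  \swd_(k, l <- h) (εK k * εL l : F^o).

Definition inK (k : K) : tensor K L := k ⊗ 1.
Definition inL (l : L) : tensor K L := 1 ⊗ l.

(* K^* and L^* as subalgebras of H^*. *)
Definition dualK (f : K -> F) (h : tensor K L) : F :=
  \swd_(k, l <- h) (f k * εL l : F^o).
Definition dualL (f : L -> F) (h : tensor K L) : F :=
  \swd_(k, l <- h) (εK k * f l : F^o).

End Bicrossproduct.

(* Products in the dual of a coalgebra with coproduct D and counit e. *)
Section DualAlgebra.
Variables (F : fieldType) (V : lmodType F) (D : V -> tensor V V) (e : V -> F).

Definition dual_mul (f g : V -> F) : V -> F :=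
  fun v => \swd_(x, y <- D v) (f x * g y : F^o).

Definition dual_pow (f : V -> F) (n : nat) : V -> F := iter n (dual_mul f) e.

Definition dual_prod (n : nat) (f : 'I_n -> V -> F) : V -> F :=
  \big[dual_mul/e]_(i < n) f i.

(* f_1^{m_1} ... f_n^{m_n} *)
Definition dual_mon (n : nat) (f : 'I_n -> V -> F) (m : {ffun 'I_n -> nat}) :
  V -> F := dual_prod (fun i => dual_pow (f i) (m i)).

(* The formal series sum_n c_n f_n in the dual: the sum is evaluated pointwise
   and has finite support at each v when the f_n are dual to a basis. *)
Definition formal_series (I : choiceType) (c : I -> F) (f : I -> V -> F) :
  V -> F := fun v => \sum_(i \in [set: I]) (c i * f i v).

Definition dual_exp (c : F) (f : V -> F) : V -> F :=
  formal_series (fun n : nat => c ^+ n / n`!%:R) (dual_pow f).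

End DualAlgebra.

Section Bases.
Variable F : fieldType.

Definition is_basis (V : lmodType F) (I : choiceType) (b : I -> V) : Prop :=
  (forall (s : seq I) (c : I -> F), uniq s ->
     \sum_(i <- s) c i *: b i = 0 -> forall i, i \in s -> c i = 0) /\
  (forall v, exists (s : seq I) (c : I -> F), v = \sum_(i <- s) c i *: b i).

Definition monomial (A : algType F) (n : nat) (g : 'I_n -> A)
  (m : {ffun 'I_n -> nat}) : A := \prod_(i < n) g i ^+ m i.

Definition mfact (n : nat) (m : {ffun 'I_n -> nat}) : nat :=
  (\prod_(i < n) (m i)`!)%N.

End Bases.

Section InducedRepresentation.
Variables (F : fieldType) (K : algType F) (L : comAlgType F).
Variables (HK : hopf_data K) (HL : hopf_data L).
Variables (act : L -> K -> L) (coact : {linear K -> tensor L K}).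

Local Notation H := (tensor K L).
Local Notation mul := (bmul HK act).
Local Notation Hmul := (dual_mul (bcop HK HL coact)).
Local Notation Hone := (bcou HK HL).

Definition induced_space (chi : L -> F) : set (H -> F) :=
  [set f | linear (f : H -> F^o) /\
           forall h l, f (mul h (inL K l)) = f h * chi l].

Definition right_act (f : H -> F) (h : H) : H -> F := fun h' => f (mul h h').

(* e^{a_1 lambda_1} ... e^{a_s lambda_s} *)
Definition psi (s : nat) (lambda : 'I_s -> {linear L -> F^o}) (a : 'I_s -> F) :
  H -> F :=
  dual_prod (bcop HK HL coact) Hone (fun j =>
    dual_exp (bcop HK HL coact) Hone (a j) (dualL HK (lambda j))).

(* kappa psi, as a product in H^* *)
Definition times_psi (p : H -> F) (kappa : {linear K -> F^o}) : H -> F :=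
  Hmul (dualK HL kappa) p.

(* The element kappa -| h of K^* with (kappa psi) -| h = (kappa -| h) psi. *)
Definition induced_act (p : H -> F) (kappa : {linear K -> F^o}) (h : H) :
  {linear K -> F^o} :=
  xget (\0 : {linear K -> F^o})
    [set kappa' | times_psi p kappa' = right_act (times_psi p kappa) h].

(* <k, kappa < k'> = <k' k, kappa> *)
Definition regular_act (kappa : K -> F) (k' : K) : K -> F :=
  fun k => kappa (k' * k).

End InducedRepresentation.

Section Flows.
Variable R : realType.

(* Local flow of the vector field X on R^s. The value of Phi outside of its
   domain D is irrelevant. *)
Record is_local_flow_on (s : nat) (X : 'rV[R]_s -> 'rV[R]_s)
    (D : set (R * 'rV[R]_s)) (Phi : R -> 'rV[R]_s -> 'rV[R]_s) : Prop := {
  flow_open : open D;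
  flow_dom0 : forall x, D (0, x);
  flow_interval : forall x, is_interval [set t | D (t, x)];
  flow0 : forall x, Phi 0 x = x;
  flowD : forall t u x, D (u, x) -> D (t, Phi u x) -> D (t + u, x) ->
    Phi (t + u) x = Phi t (Phi u x);
  flow_derive : forall (f : 'rV[R]_s -> R) x, differentiable f x ->
    is_derive (0 : R) 1 (fun t => f (Phi t x)) ('D_(X x) f x) }.

Definition is_local_flow (s : nat) (X : 'rV[R]_s -> 'rV[R]_s)
  (Phi : R -> 'rV[R]_s -> 'rV[R]_s) : Prop :=
  exists D, is_local_flow_on X D Phi.

(* Derivative of a complex-valued function along a real direction. *)
Definition cderive (n : nat) (v : 'rV[R]_n) (f : 'rV[R]_n -> R[i]) :
  'rV[R]_n -> R[i] :=
  fun x => 'D_v (fun y => complex.Re (f y)) x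
           +i* 'D_v (fun y => complex.Im (f y)) x.

(* flow_comp Phi [:: i_1; ...; i_p] t = Phi_{i_p}^{t_{i_p}} o ... o
   Phi_{i_1}^{t_{i_1}} *)
Definition flow_comp (r s : nat) (Phi : 'I_r -> R -> 'rV[R]_s -> 'rV[R]_s)
  (w : seq 'I_r) (t : 'rV[R]_r) (x : 'rV[R]_s) : 'rV[R]_s :=
  foldl (fun y i => Phi i (t 0 i) y) x w.

(* Taylor coefficient of t^m at t = 0. For w = [:: i_1; ...; i_p] listing the
   indices, the m-th derivative is taken as d_{i_1}^{m_{i_1}} ...
   d_{i_p}^{m_{i_p}}; the order does not matter for smooth f. *)
Definition taylor_coef (r : nat) (w : seq 'I_r) (f : 'rV[R]_r -> R[i])
  (m : {ffun 'I_r -> nat}) : R[i] :=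
  foldr (fun i g => iter (m i) (cderive (delta_mx 0 i)) g) f w 0
    / (mfact m)%:R.

(* The element of K^* got from the Taylor expansion at 0 of
   ltilde (flow_comp Phi w t a) by replacing the t_i by the kappa_i.
   Pitfall: flows act on functions by pull-back, so if Phi_i is the flow of
   X_i = (_ <| k_i), then for w = [:: i_1; ...; i_p] the m-th derivative of
   l (flow_comp Phi w t a) at t = 0 is the value at a of
   l <| (k_{i_p}^{m_{i_p}} ... k_{i_1}^{m_{i_1}}). The ordered monomials
   k_1^{m_1} ... k_r^{m_r} thus correspond to the decreasing list of indices,
   that is to Phi_1^{t_1} o ... o Phi_r^{t_r}. *)
Definition flow_series (r s : nat) (K : algType R[i]) (HK : hopf_data K)
  (kappa : 'I_r -> {linear K -> R[i]^o})
  (Phi : 'I_r -> R -> 'rV[R]_s -> 'rV[R]_s) (w : seq 'I_r)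
  (ltilde : 'rV[R]_s -> R[i]) (a : 'rV[R]_s) : K -> R[i] :=
  formal_series
    (taylor_coef w (fun t => ltilde (flow_comp Phi w t a)))
    (dual_mon (cop HK) (cou HK) kappa).

End Flows.

(* Main.v *)
(* On elementary tensors, the dual of [H] is multiplied by the rules
   [(f (x) eps) (f' (x) g) = (f f') (x) g] and
   [(eps (x) g) (eps (x) g') = eps (x) (g g')], so the pairing splits into
   dualities on [K] and on [L], and evaluating the product of exponentials on
   the basis [l_n] gives [psi = eps (x) chi].  Hence [kappa psi = kappa (x) chi],
   every element of the induced space is of this form, and the product of [H]
   yields [kappa -| k = kappa (k _)] and [kappa -| l = kappa * (chi (l <| _))].
   The character [chi] is evaluation at [a], and differentiating along the flows
   replaces [g] by [g <| k_i], so the Taylor coefficients of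
   [l_j (Phi_t (a))] are the values [chi (l_j <| k_m) / m!], which are the
   coordinates of [chi (l_j <| _)] in the series in the [kappa^m]. *)
Require Import Defs.
From HB Require Import structures.
From mathcomp Require Import all_boot all_order all_algebra.
From mathcomp Require Import all_classical all_reals all_analysis.
From mathcomp.real_closed Require Import complex.
Import Order.TTheory GRing.Theory Num.Theory numFieldNormedType.Exports.
Local Open Scope ring_scope.
Local Open Scope classical_set_scope.
Local Open Scope complex_scope.

Set Implicit Arguments.
Unset Strict Implicit.
Unset Printing Implicit Defensive.

(** * Linear maps and their determination by a basis *)

Section LinearMaps.
Variable F : fieldType.
Implicit Types U V W Z : lmodType F.

Lemma linear_map0 V W (f : V -> W) : linear f -> f 0 = 0.
Proof. by move=> lf; have := lf (-1) 0 0; rewrite scaler0 addr0 scaleN1r addNr. Qed.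

Lemma linear_mapD V W (f : V -> W) : linear f -> {morph f : u v / u + v}.
Proof. by move=> lf u v; have := lf 1 u v; rewrite !scale1r. Qed.

Lemma linear_mapZ V W (f : V -> W) : linear f -> forall c, {morph f : u / c *: u}.
Proof. by move=> lf c u; have := lf c u 0; rewrite (linear_map0 lf) !addr0. Qed.

Lemma linear_big V W (f : V -> W) (I : Type) (s : seq I) (g : I -> V) :
  linear f -> f (\sum_(i <- s) g i) = \sum_(i <- s) f (g i).
Proof.
move=> lf; apply: (big_morph f); first exact: linear_mapD.
exact: linear_map0.
Qed.

Lemma linear_comp V W Z (f : W -> Z) (g : V -> W) :
  linear f -> linear g -> linear (fun v => f (g v)).
Proof. by move=> lf lg c u v; rewrite lg lf. Qed.

(** Beyond the underlying function, a packed linear map holds only proofs, which proof irrelevance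
    identifies. *)
Lemma linear_eq V W (f g : {linear V -> W}) : f = g :> (V -> W) -> f = g.
Proof.
case: f g => [f [cf df]] [g [cg dg]] /= fg; move: cf df cg dg; rewrite fg.
move=> [cf] [df] [cg] [dg].
by rewrite (Prop_irrelevance cf cg) (Prop_irrelevance df dg).
Qed.

Definition pack_linear V W (f : V -> W) (lf : linear f) : {linear V -> W} :=
  HB.pack f (GRing.isLinear.Build F V W *:%R f lf).

Lemma linear_basis V W (I : choiceType) (b : I -> V) (f g : V -> W) :
  is_basis b -> linear f -> linear g -> (forall i, f (b i) = g (b i)) -> f = g.
Proof.
move=> [_ bs] lf lg fg; apply/funext => v; have [s [c ->]] := bs v.
rewrite !linear_big//; apply: eq_bigr => i _.
by rewrite (linear_mapZ lf) (linear_mapZ lg) fg.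
Qed.

End LinearMaps.

(** * Calculus of Sweedler sums *)

Section TensorCalculus.
Variable F : fieldType.
Implicit Types U V W Z : lmodType F.

Lemma tlift_linear V W Z (B : V -> W -> Z) :
  bilinear_map B -> linear (tlift B).
Proof.
move=> bB c x y.
by rewrite [LHS](tlift_add (tscale c x) y bB) (tlift_scale c x bB).
Qed.

Lemma tens_bilinear V W : bilinear_map (@tens F V W).
Proof.
split=> [w|v] c x y; apply: tensorP => Z B bB;
  rewrite (tlift_linear bB) !tlift_tens//.
  by rewrite bB.1.
by rewrite bB.2.
Qed.

(** Both sides are sums over the same list [repr t], so [f] passes through term by term. *)
Lemma linear_tlift V W Z Z' (f : Z -> Z') (B : V -> W -> Z) t :
  linear f -> f (tlift B t) = tlift (fun x y => f (B x y)) t.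
Proof. by move=> lf; rewrite /tlift /tsum linear_big. Qed.

Lemma eq_tlift V W Z (B B' : V -> W -> Z) t :
  (forall x y, B x y = B' x y) -> tlift B t = tlift B' t.
Proof. by move=> BB'; apply: eq_bigr. Qed.

Lemma tlift_id V W (t : tensor V W) : tlift (@tens F V W) t = t.
Proof.
apply: tensorP => Z B bB; rewrite (linear_tlift _ _ (tlift_linear bB)).
by apply: eq_tlift => v w; rewrite tlift_tens.
Qed.

Lemma linear_tlift_param U V W Z (G : U -> V -> W -> Z) t :
  (forall x y, linear (fun u => G u x y)) -> linear (fun u => tlift (G u) t).
Proof.
move=> lG c u v; rewrite /tlift /tsum scaler_sumr -big_split /=.
by apply: eq_bigr => p _; rewrite lG.
Qed.

Lemma tlift_swap V W V' W' Z (G : V -> W -> V' -> W' -> Z) t t' :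
  \swd_(x, y <- t) \swd_(x', y' <- t') G x y x' y' =
  \swd_(x', y' <- t') \swd_(x, y <- t) G x y x' y'.
Proof. exact: exchange_big. Qed.

Lemma tliftMl V W c (G : V -> W -> F) (t : tensor V W) :
  \swd_(x, y <- t) (c * G x y : F^o) = c * \swd_(x, y <- t) (G x y : F^o).
Proof. by rewrite /tlift /tsum mulr_sumr. Qed.

Lemma tliftMr V W c (G : V -> W -> F) (t : tensor V W) :
  \swd_(x, y <- t) (G x y * c : F^o) = (\swd_(x, y <- t) (G x y : F^o)) * c.
Proof. by rewrite /tlift /tsum mulr_suml. Qed.

Lemma bilinear_mul V W (f : V -> F) (g : W -> F) :
  linear (f : V -> F^o) -> linear (g : W -> F^o) ->
  bilinear_map (fun v w => f v * g w : F^o).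
Proof.
move=> lf lg; split=> [w|v] c x y.
  rewrite lf mulrDl; congr (_ + _); exact/esym/mulrA.
rewrite lg mulrDr; congr (_ + _); exact: mulrCA.
Qed.

End TensorCalculus.

(** * The convolution algebra dual to a Hopf algebra *)

Section CoalgebraDual.
Variables (F : fieldType) (A : algType F) (D : hopf_data A).
Hypothesis hD : is_hopf D.
Implicit Types f g : A -> F.

Local Notation "f ** g" := (dual_mul (cop D) f g) (at level 40).

Lemma cou_linear : linear (cou D : A -> F^o).
Proof. by move=> c x y; rewrite linearP. Qed.

Lemma dual_mul_linear f g :
  linear (f : A -> F^o) -> linear (g : A -> F^o) -> linear (f ** g : A -> F^o).
Proof.
move=> lf lg; apply: (@linear_comp _ _ _ _ (tlift _)).
  exact/tlift_linear/bilinear_mul.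
by move=> c x y; rewrite linearP.
Qed.

Lemma dual_mul1l f : linear (f : A -> F^o) -> cou D ** f = f.
Proof.
move=> lf; apply/funext => v; rewrite -[in RHS](cou_left hD v).
rewrite (linear_tlift _ _ lf); apply: (@eq_tlift _ A A F^o) => x y.
by rewrite (linear_mapZ lf).
Qed.

Lemma dual_mul1r f : linear (f : A -> F^o) -> f ** cou D = f.
Proof.
move=> lf; apply/funext => v; rewrite -[in RHS](cou_right hD v).
rewrite (linear_tlift _ _ lf); apply: (@eq_tlift _ A A F^o) => x y.
by rewrite (linear_mapZ lf) mulrC.
Qed.

Lemma dual_pow_linear f n :
  linear (f : A -> F^o) -> linear (dual_pow (cop D) (cou D) f n : A -> F^o).
Proof.
by move=> lf; elim: n => [|n IHn]; [exact: cou_linear|exact: dual_mul_linear].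
Qed.

Lemma dual_big_linear (I : Type) (s : seq I) (f : I -> A -> F) :
  (forall i, linear (f i : A -> F^o)) ->
  linear (\big[dual_mul (cop D)/cou D : A -> F]_(i <- s) f i : A -> F^o).
Proof.
move=> lf; elim: s => [|i s IHs]; rewrite ?big_nil ?big_cons.
  exact: cou_linear.
exact: dual_mul_linear.
Qed.

End CoalgebraDual.

(** * Formal series of functionals *)

Section FormalSeries.
Variables (F : fieldType) (I : choiceType).
Implicit Types (V : lmodType F) (c : I -> F).

(** Pointwise finite support, as for a family dual to a basis. It makes [formal_series] a genuine
    finite sum at each vector, where infinitely many nonzero terms would give the default value
    0. *)
Definition summable V (f : I -> V -> F) : Prop :=
  forall v, exists s : seq I, forall i, i \notin s -> f i v = 0.

Lemma formal_seriesE V c (f : I -> V -> F) v (s : seq I) : uniq s ->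
  (forall i, i \notin s -> c i * f i v = 0) ->
  formal_series c f v = \sum_(i <- s) c i * f i v.
Proof.
move=> us fs; rewrite /formal_series (fsbigE s)//.
- by apply: eq_bigl => i; rewrite in_setT.
- by move=> i _ /fs.
Qed.

Lemma formal_series1 V c (f : I -> V -> F) v i0 :
  (forall i, i != i0 -> c i * f i v = 0) ->
  formal_series c f v = c i0 * f i0 v.
Proof.
move=> f0; rewrite (@formal_seriesE _ _ _ _ [:: i0])// ?big_seq1//.
by move=> i; rewrite inE => /f0.
Qed.

Lemma summable_seq V (f : I -> V -> F) (J : Type) (t : seq J) (x : J -> V) :
  summable f -> exists2 s : seq I, uniq s &
    forall i, i \notin s -> forall w : J -> F,
      \sum_(j <- t) f i (x j) * w j = 0.
Proof.
move=> sf; elim: t => [|j t [s us IHs]].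
  by exists [::] => // i _ w; rewrite big_nil.
have [s' fs'] := sf (x j); exists (undup (s ++ s')); first exact: undup_uniq.
move=> i; rewrite mem_undup mem_cat negb_or => /andP[/IHs si /fs' s'i] w.
by rewrite big_cons s'i si mul0r addr0.
Qed.

(** Finitely many points [x j] share a finite list of indices off which all terms vanish, so two
    finite sums are exchanged. The point [v] is a dummy: the series on the right has terms constant
    in it. *)
Lemma formal_series_sum V V' c (f : I -> V -> F) (J : Type) (t : seq J)
    (x : J -> V) (w : J -> F) (v : V') : summable f ->
  \sum_(j <- t) formal_series c f (x j) * w j =
  formal_series c (fun i _ => \sum_(j <- t) f i (x j) * w j) v.
Proof.
move=> sf; elim: t => [|j t IHt].
  rewrite big_nil (@formal_seriesE _ _ _ _ [::]) ?big_nil// => i _.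
  by rewrite big_nil mulr0.
rewrite big_cons IHt.
have [s us fs] := summable_seq t x sf.
have [s' fs'] := sf (x j).
pose s1 := undup (s ++ s').
have s1P i : i \notin s1 -> (f i (x j) = 0) * (\sum_(j <- t) f i (x j) * w j = 0).
  rewrite mem_undup mem_cat negb_or => /andP[/fs si /fs' s'i].
  by split.
rewrite !(@formal_seriesE _ _ _ _ s1) ?undup_uniq//; last first.
- by move=> i /s1P ->; rewrite mulr0.
- by move=> i /s1P E; rewrite E mulr0.
- by move=> i /s1P E; rewrite big_cons !E mul0r addr0 mulr0.
rewrite mulr_suml -big_split; apply: eq_bigr => i _ /=.
by rewrite big_cons mulrDr mulrA.
Qed.

Lemma formal_series_linear V c (f : I -> V -> F) : summable f ->
  (forall i, linear (f i : V -> F^o)) ->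
  linear (formal_series c f : V -> F^o).
Proof.
move=> sf lf a u v; have [s fs] := sf u; have [s' fs'] := sf v.
pose s1 := undup (s ++ s').
have s1P i : i \notin s1 -> (f i u = 0) * (f i v = 0).
  by rewrite mem_undup mem_cat negb_or => /andP[/fs-> /fs'->].
rewrite !(@formal_seriesE _ _ _ _ s1) ?undup_uniq//; first last.
1-3: by move=> i /s1P E; rewrite ?lf !E ?scaler0 ?addr0 mulr0.
rewrite scaler_sumr -big_split; apply: eq_bigr => i _ /=.
by rewrite lf mulrDr; congr (_ + _); exact: mulrCA.
Qed.

(** Only the indices occurring in an expansion of [v] on the basis can contribute. *)
Lemma dual_summable V (b : I -> V) (f : I -> V -> F) : is_basis b ->
  (forall i, linear (f i : V -> F^o)) ->
  (forall i j, i != j -> f i (b j) = 0) -> summable f.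
Proof.
move=> [_ bs] lf f0 v; have [s [c ->]] := bs v; exists s => i si.
rewrite (linear_big _ _ (lf i)) big1_seq// => j /andP[_ js].
rewrite (linear_mapZ (lf i)) f0 ?scaler0//.
by apply: contraNneq si => ->.
Qed.

(** [D v] is a finite sum, so it can be exchanged with the series, the values of [h] on the second
    legs serving as weights. *)
Lemma dual_mul_formall V (D : V -> tensor V V) c (f : I -> V -> F) h :
  summable f ->
  dual_mul D (formal_series c f) h = formal_series c (fun i => dual_mul D (f i) h).
Proof.
move=> sf; apply/funext => v.
exact: (formal_series_sum c (repr (D v)) fst (fun p => h p.2) v sf).
Qed.

(** Only the scalar factors are exchanged, not the legs of [D v]; this is not commutativity of the
    dual product. It puts a series in the right factor where [formal_series_sum] expects it. *)
Lemma dual_mulC_tlift V (D : V -> tensor V V) (f g : V -> F) v :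
  dual_mul D f g v = \swd_(x, y <- D v) (g y * f x : F^o).
Proof. by apply: (@eq_tlift _ V V F^o) => x y; rewrite mulrC. Qed.

Lemma dual_mul_formalr V (D : V -> tensor V V) c (f : I -> V -> F) h :
  summable f ->
  dual_mul D h (formal_series c f) = formal_series c (fun i => dual_mul D h (f i)).
Proof.
move=> sf; apply/funext => v; rewrite dual_mulC_tlift.
rewrite [LHS](formal_series_sum c (repr (D v)) snd (fun p => h p.1) v sf).
apply: eq_fsbigr => i _.
by rewrite dual_mulC_tlift.
Qed.

End FormalSeries.

(** * Ordered products of exponentials of dual generators *)

Section DualExponentials.
Variables (F : fieldType) (A : algType F) (D : hopf_data A).
Hypothesis hD : is_hopf D.
Hypothesis F0 : [pchar F] =i pred0.
Variables (s : nat) (b : {ffun 'I_s -> nat} -> A) (lam : 'I_s -> A -> F).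
Hypothesis b_basis : is_basis b.
Hypothesis lam_linear : forall j, linear (lam j : A -> F^o).
Local Notation mon := (dual_mon (cop D) (cou D) lam).
Hypothesis lam_dual : forall m n, mon m (b n) = (m == n)%:R * (mfact n)%:R.
Variable a : 'I_s -> F.

Local Notation "f ** g" := (dual_mul (cop D) f g) (at level 40).
Local Notation pow j p := (dual_pow (cop D) (cou D) (lam j) p).
Local Notation dexp j := (dual_exp (cop D) (cou D) (a j) (lam j)).

Lemma dual_mon_linear m : linear (mon m : A -> F^o).
Proof. by apply: dual_big_linear => i; exact: dual_pow_linear. Qed.

Lemma dual_mon_summable : summable mon.
Proof.
apply: (dual_summable b_basis); first exact: dual_mon_linear.
by move=> m n mn; rewrite lam_dual (negPf mn) mul0r.
Qed.

(** The leading factors have exponent 0, hence equal the counit, which is the unit of the dual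
    product. *)
Lemma dual_mon_suffix q1 q2 (m : {ffun 'I_s -> nat}) :
  index_enum 'I_s = q1 ++ q2 -> (forall i, i \in q1 -> m i = 0%N) ->
  mon m = \big[dual_mul (cop D)/cou D : A -> F]_(i <- q2) pow i (m i).
Proof.
rewrite /dual_mon /dual_prod => ->; elim: q1 => //= j q1 IHq1 m0.
rewrite big_cons IHq1; last by move=> i iq1; apply: m0; rewrite inE iq1 orbT.
rewrite m0 ?mem_head// dual_mul1l//; apply: dual_big_linear => i.
exact: dual_pow_linear.
Qed.

Definition upd (m : {ffun 'I_s -> nat}) j p : {ffun 'I_s -> nat} :=
  [ffun i => if i == j then p else m i].

(** The dual product need not commute, so a power of [lam j] is absorbed on the left only by a
    monomial whose generators all come after [j]. Then [m j] is 0, and the exponent of [j] becomes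
    [p]. *)
Lemma dual_pow_mul_mon q1 j q2 (m : {ffun 'I_s -> nat}) p :
  index_enum 'I_s = q1 ++ j :: q2 -> (forall i, i \notin q2 -> m i = 0%N) ->
  pow j p ** mon m = mon (upd m j p).
Proof.
move=> e m0; have := index_enum_uniq 'I_s.
rewrite e cat_uniq /= negb_or => /and3P[_ /andP[jq1 q1q2] /andP[jq2 _]].
have disj i : i \in q1 -> i \notin q2.
  by move=> iq1; apply: contra q1q2 => iq2; apply/hasP; exists i.
rewrite [in RHS](@dual_mon_suffix q1 (j :: q2))//; last first.
  move=> i iq1; rewrite ffunE; case: eqP => [ij|_]; first by rewrite -ij iq1 in jq1.
  by apply: m0; exact: disj.
rewrite (@dual_mon_suffix (rcons q1 j) q2) ?cat_rcons//; last first.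
  move=> i; rewrite mem_rcons inE => /orP[/eqP->|/disj]; last exact: m0.
  exact: m0.
rewrite big_cons ffunE eqxx; congr (_ ** _).
apply: eq_big_seq => i iq2; rewrite ffunE; case: eqP => // ij.
by rewrite -ij iq2 in jq2.
Qed.

Lemma dual_mon0 : mon [ffun=> 0%N] = cou D.
Proof.
rewrite (@dual_mon_suffix (index_enum 'I_s) [::]) ?cats0 ?big_nil// => i _.
by rewrite ffunE.
Qed.

Lemma index_enum_split (j : 'I_s) : exists q1 q2, index_enum 'I_s = q1 ++ j :: q2.
Proof.
by move: (mem_index_enum j); case/path.splitPr => q1 q2; exists q1, q2.
Qed.

(** Powers of one generator are themselves monomials, and the family of monomials is summable. *)
Lemma dual_pow_summable j : summable (fun p => pow j p).
Proof.
move=> v; have [t mt] := dual_mon_summable v.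
exists [seq m j | m : {ffun 'I_s -> nat} <- t] => p pt.
have [q1 [q2 e]] := index_enum_split j.
have -> : pow j p = mon (upd [ffun=> 0%N] j p).
  rewrite -(@dual_pow_mul_mon q1 j q2)//; last by move=> i _; rewrite ffunE.
  by rewrite dual_mon0 dual_mul1r//; exact: dual_pow_linear.
apply: mt; apply: contra pt => mt'; apply/mapP.
by exists (upd [ffun=> 0%N] j p); rewrite ?ffunE ?eqxx.
Qed.

Definition supp_in (q : seq 'I_s) (m : {ffun 'I_s -> nat}) : bool :=
  [forall i, (i \notin q) ==> (m i == 0%N)].

Lemma supp_inP q (m : {ffun 'I_s -> nat}) :
  reflect (forall i, i \notin q -> m i = 0%N) (supp_in q m).
Proof.
by apply: (iffP 'forall_implyP) => m0 i iq; apply/eqP; rewrite (m0 _ iq).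
Qed.

(** The coefficient of [mon m] in the product of the exponentials over [q]. Under the support
    condition the factors with [i] outside [q] are 1. *)
Definition exp_coef q m : F :=
  if supp_in q m then (\prod_i a i ^+ m i) / (mfact m)%:R else 0.

Lemma mfact_neq0 (m : {ffun 'I_s -> nat}) : (mfact m)%:R != 0 :> F.
Proof.
rewrite (iffLR (pcharf0P F) F0) -lt0n /mfact.
by apply: prodn_gt0 => i; exact: fact_gt0.
Qed.

Lemma dual_exp_linear j : linear (dexp j : A -> F^o).
Proof.
apply: formal_series_linear; first exact: dual_pow_summable.
by move=> p; exact: dual_pow_linear.
Qed.

(* The value on the basis determines the partial product of exponentials, so
   that the induction hypothesis gives its expansion in the [mon m]. *)
Lemma big_dual_exp_basis q1 q2 n : index_enum 'I_s = q1 ++ q2 ->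
  (\big[dual_mul (cop D)/cou D : A -> F]_(i <- q2) dexp i) (b n) =
  exp_coef q2 n * (mfact n)%:R.
Proof.
elim: q2 q1 n => [|j q2 IHq2] q1 n e.
  rewrite big_nil -dual_mon0 lam_dual eq_sym /exp_coef; congr (_ * _).
  have -> : supp_in [::] n = (n == [ffun=> 0%N]).
    apply/supp_inP/eqP => [n0|-> i _]; last by rewrite ffunE.
    by apply/ffunP => i; rewrite ffunE n0.
  case: eqP => // ->; rewrite big1 => [|i _]; last by rewrite ffunE.
  by rewrite /mfact big1 ?divr1// => i _; rewrite ffunE.
have := index_enum_uniq 'I_s; rewrite e cat_uniq /= => /and3P[_ _ /andP[jq2 _]].
rewrite big_cons; set X := \big[_/_]_(i <- q2) _ in IHq2 *.
have XE : X = formal_series (exp_coef q2) mon.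
  apply: (linear_basis (W := F^o) b_basis).
  - by apply: dual_big_linear => i; exact: dual_exp_linear.
  - by apply: formal_series_linear; [exact: dual_mon_summable|exact: dual_mon_linear].
  move=> m; rewrite (IHq2 (rcons q1 j)) ?cat_rcons//.
  rewrite (@formal_series1 _ _ _ _ _ _ m) ?lam_dual ?eqxx ?mul1r//.
  by move=> m' mm'; rewrite lam_dual (negPf mm') mul0r mulr0.
(* If [m] is not supported in [q2] its coefficient is 0; otherwise the multiplication rule for
   monomials applies. *)
have mulE m p : exp_coef q2 m * (pow j p ** mon m) (b n) =
    exp_coef q2 m * ((upd m j p == n)%:R * (mfact n)%:R).
  rewrite /exp_coef; case: supp_inP => [m0|_]; last by rewrite !mul0r.
  by rewrite (@dual_pow_mul_mon q1 j q2)// lam_dual.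
rewrite XE /dual_exp dual_mul_formall; last exact: dual_pow_summable.
(* Comparing exponents at [j] leaves only the term [p = n j] of the exponential of [lam j]. *)
rewrite (@formal_series1 _ _ _ _ _ _ (n j)); last first.
  move=> p pn; rewrite dual_mul_formalr; last exact: dual_mon_summable.
  (* Every term vanishes here, so the index [n] singled out is arbitrary. *)
  rewrite (@formal_series1 _ _ _ _ _ _ n) => [|m _]; rewrite mulE.
    rewrite [_ == _](_ : _ = false) ?mul0r ?mulr0//.
    by apply: contraNF pn => /eqP <-; rewrite ffunE eqxx.
  rewrite [_ == _](_ : _ = false) ?mul0r ?mulr0//.
  by apply: contraNF pn => /eqP <-; rewrite ffunE eqxx.
rewrite dual_mul_formalr; last exact: dual_mon_summable.
(* A multi-index supported in [q2] is 0 at [j], so only [n] with its entry at [j] erased can produce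
   [n]. *)
rewrite (@formal_series1 _ _ _ _ _ _ (upd n j 0)) => [|m mn]; rewrite mulE.
  have -> : upd (upd n j 0) j (n j) = n.
    by apply/ffunP => i; rewrite !ffunE; case: eqP => // ->.
  rewrite eqxx mul1r mulrA; congr (_ * _); rewrite /exp_coef.
  have -> : supp_in q2 (upd n j 0) = supp_in (j :: q2) n.
    apply/supp_inP/supp_inP => n0 i; last first.
      by move=> iq2; rewrite ffunE; case: eqP => // /eqP ij; rewrite n0// inE negb_or ij.
    by rewrite inE negb_or => /andP[/negPf ij /n0]; rewrite ffunE ij.
  case: ifP => _; last by rewrite mulr0.
  (* Splitting the index [j] off the power product and off the factorial exhibits the factor
     contributed by the exponential of [lam j]. *)
  have aE m : \prod_i a i ^+ m i = a j ^+ m j * \prod_(i | i != j) a i ^+ m i.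
    exact: bigD1.
  have fE m : mfact m = ((m j)`! * \prod_(i | i != j) (m i)`!)%N by exact: bigD1.
  rewrite !aE !fE !ffunE eqxx expr0 mul1r fact0 mul1n.
  rewrite natrM invfM mulrACA; congr (_ * _ * (_ / _%:R)).
    by apply: eq_bigr => i /negPf ij; rewrite ffunE ij.
  by apply: eq_bigr => i /negPf ij; rewrite ffunE ij.
rewrite /exp_coef; case: supp_inP => [m0|_]; last by rewrite !mul0r.
rewrite [_ == _](_ : _ = false) ?mul0r ?mulr0//.
apply: contraNF mn => /eqP <-; apply/eqP/ffunP => i; rewrite !ffunE.
by case: eqP => // ->; exact: m0.
Qed.

Lemma dual_prod_exp_basis n :
  dual_prod (cop D) (cou D) (fun j => dexp j) (b n) = \prod_j a j ^+ n j.
Proof.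
rewrite [LHS](@big_dual_exp_basis [::])// /exp_coef ifT ?divfK ?mfact_neq0//.
by apply/supp_inP => i; rewrite mem_index_enum.
Qed.

End DualExponentials.

(** * Products in the dual of the bicrossproduct *)

Section BicrossproductDual.
Variables (F : fieldType) (K : algType F) (L : comAlgType F).
Variables (HK : hopf_data K) (HL : hopf_data L).
Variables (act : L -> K -> L) (coact : {linear K -> tensor L K}).
Hypothesis bicross : is_bicrossproduct HK HL act coact.

Local Notation H := (tensor K L).
Local Notation Hmul := (dual_mul (bcop HK HL coact)).
Local Notation Hone := (bcou HK HL).
Local Notation Kmul := (dual_mul (cop HK)).
Local Notation Lmul := (dual_mul (cop HL)).

Implicit Types (f : K -> F) (g : L -> F).

Let hK := bicross_hopfK bicross.
Let hL := bicross_hopfL bicross.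
Let hact := bicross_act bicross.
Let hcoact := bicross_coact bicross.

(** The functional [f ⊗ g] on [H]. By conversion, [dualK HL f] is [bidual f (cou HL)] and
    [dualL HK g] is [bidual (cou HK) g]. *)
Definition bidual (f : K -> F) (g : L -> F) (h : H) : F :=
  \swd_(k, l <- h) (f k * g l : F^o).

Lemma bidual_linear f g : linear (f : K -> F^o) -> linear (g : L -> F^o) ->
  linear (bidual f g : H -> F^o).
Proof. by move=> lf lg; exact/tlift_linear/bilinear_mul. Qed.

Lemma bidual_tens f g k l : linear (f : K -> F^o) -> linear (g : L -> F^o) ->
  bidual f g (k ⊗ l) = f k * g l.
Proof. by move=> lf lg; exact: (tlift_tens k l (bilinear_mul lf lg)). Qed.

Lemma dual_mul_bcop (f g : H -> F) h :
  linear (f : H -> F^o) -> linear (g : H -> F^o) ->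
  Hmul f g h = \swd_(k, l <- h) \swd_(k1, k2 <- cop HK k)
    \swd_(u, k2' <- coact k2) \swd_(l1, l2 <- cop HL l)
      (f (k1 ⊗ (u * l1)) * g (k2' ⊗ l2) : F^o).
Proof.
move=> lf lg; have bB := bilinear_mul lf lg; have lB := tlift_linear bB.
rewrite /dual_mul /bcop (linear_tlift _ _ lB); apply: (@eq_tlift _ K L F^o) => k l.
rewrite (linear_tlift _ _ lB); apply: (@eq_tlift _ K K F^o) => k1 k2.
rewrite (linear_tlift _ _ lB); apply: (@eq_tlift _ L K F^o) => u k2'.
rewrite (linear_tlift _ _ lB); apply: (@eq_tlift _ L L F^o) => l1 l2.
exact: tlift_tens.
Qed.

(** The left factor applies the counit of [L] to [u * l1]. Being multiplicative, this counit removes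
    the coaction leg [u] by the counit axiom of the coaction, and [l1] by that of [L]. *)
Lemma bidual_mulKL f (f' : K -> F) g : linear (f : K -> F^o) -> linear (f' : K -> F^o) ->
  linear (g : L -> F^o) ->
  Hmul (dualK HL f) (bidual f' g) = bidual (Kmul f f') g.
Proof.
move=> lf lf' lg; apply/funext => h.
rewrite dual_mul_bcop; [|exact: bidual_linear (cou_linear _)|exact: bidual_linear].
apply: (@eq_tlift _ K L F^o) => k l; rewrite /dual_mul -tliftMr.
apply: (@eq_tlift _ K K F^o) => k1 k2.
have -> : f' k2 = \swd_(u, k' <- coact k2) (cou HL u * f' k' : F^o).
  rewrite -[in LHS](coact_cou hcoact k2) (linear_tlift _ _ lf').
  by apply: (@eq_tlift _ L K F^o) => u k'; exact: linear_mapZ.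
rewrite -tliftMl -tliftMr; apply: (@eq_tlift _ L K F^o) => u k'.
rewrite -[in RHS](dual_mul1l hL lg) /dual_mul -tliftMl.
apply: (@eq_tlift _ L L F^o) => l1 l2.
rewrite [dualK _ _ _](bidual_tens _ _ lf (cou_linear HL)) bidual_tens//.
by rewrite (couM hL) !mulrA [_ * cou HL l1 * _]mulrAC.
Qed.

(** The counit of [K] falls on the coacted leg, and [coact_couK] then turns the other leg [u] into a
    scalar multiple of 1. *)
Lemma bidual_mulLL g (g' : L -> F) : linear (g : L -> F^o) -> linear (g' : L -> F^o) ->
  Hmul (dualL HK g) (dualL HK g') = dualL HK (Lmul g g').
Proof.
move=> lg lg'; have lK := cou_linear HK; apply/funext => h.
rewrite dual_mul_bcop; [|exact: bidual_linear|exact: bidual_linear].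
apply: (@eq_tlift _ K L F^o) => k l.
rewrite -[in RHS](dual_mul1l hK lK) /dual_mul -tliftMr.
apply: (@eq_tlift _ K K F^o) => k1 k2.
rewrite tlift_swap -tliftMl; apply: (@eq_tlift _ L L F^o) => l1 l2.
(* The scalar [cou HK k2] is moved inside [g], where [coact_couK] can expand it. *)
have -> : (cou HK k1 : F) * cou HK k2 * (g l1 * g' l2) =
    (cou HK k1 : F) * g' l2 * g ((cou HK k2 *: 1) * l1).
  rewrite mulr_algl (linear_mapZ lg) -mulrA -[RHS]mulrA; congr (_ * _).
  by rewrite mulrA [RHS]mulrC.
have lm : linear (fun x : L => g (x * l1) : F^o).
  by apply: (linear_comp lg) => c x y; rewrite mulrDl scalerAl.
have -> : g ((cou HK k2 *: 1) * l1) =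
    \swd_(u, k' <- coact k2) (g ((cou HK k' *: u) * l1) : F^o).
  by rewrite -(coact_couK hcoact); exact: (linear_tlift _ _ lm).
rewrite -tliftMl; apply: (@eq_tlift _ L K F^o) => u k'.
rewrite [dualL _ _ _](bidual_tens _ _ lK lg) [dualL _ _ _](bidual_tens _ _ lK lg').
rewrite -scalerAl (linear_mapZ lg) [LHS]mulrACA [RHS]mulrACA.
by congr (_ * _); exact: mulrC.
Qed.

Lemma dual_pow_dualL g n : linear (g : L -> F^o) ->
  dual_pow (bcop HK HL coact) Hone (dualL HK g) n =
  dualL HK (dual_pow (cop HL) (cou HL) g n).
Proof.
move=> lg; elim: n => [//|n IHn]; rewrite {1}/dual_pow iterS -/(dual_pow _ _ _ _).
by rewrite IHn bidual_mulLL//; exact: dual_pow_linear.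
Qed.

Lemma dual_pow_dualK f n : linear (f : K -> F^o) ->
  dual_pow (bcop HK HL coact) Hone (dualK HL f) n =
  dualK HL (dual_pow (cop HK) (cou HK) f n).
Proof.
move=> lf; elim: n => [//|n IHn]; rewrite {1}/dual_pow iterS -/(dual_pow _ _ _ _).
by rewrite IHn bidual_mulKL//; [exact: dual_pow_linear|exact: cou_linear].
Qed.

Lemma dual_prod_dualL n (g : 'I_n -> L -> F) :
  (forall j, linear (g j : L -> F^o)) ->
  dual_prod (bcop HK HL coact) Hone (fun j => dualL HK (g j)) =
  dualL HK (dual_prod (cop HL) (cou HL) g).
Proof.
move=> lg; rewrite /dual_prod; elim: (index_enum _) => [|j q IHq].
  by rewrite !big_nil.
by rewrite !big_cons IHq bidual_mulLL//; exact: dual_big_linear.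
Qed.

Lemma dual_prod_dualK n (f : 'I_n -> K -> F) :
  (forall j, linear (f j : K -> F^o)) ->
  dual_prod (bcop HK HL coact) Hone (fun j => dualK HL (f j)) =
  dualK HL (dual_prod (cop HK) (cou HK) f).
Proof.
move=> lf; rewrite /dual_prod; elim: (index_enum _) => [|j q IHq].
  by rewrite !big_nil.
rewrite !big_cons IHq bidual_mulKL//; [exact: dual_big_linear|exact: cou_linear].
Qed.

Lemma dual_mon_dualL n (g : 'I_n -> L -> F) m :
  (forall j, linear (g j : L -> F^o)) ->
  dual_mon (bcop HK HL coact) Hone (fun j => dualL HK (g j)) m =
  dualL HK (dual_mon (cop HL) (cou HL) g m).
Proof.
move=> lg; rewrite -dual_prod_dualL => [|j]; last exact: dual_pow_linear.
by congr dual_prod; apply/funext => j; exact: dual_pow_dualL.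
Qed.

Lemma dual_mon_dualK n (f : 'I_n -> K -> F) m :
  (forall j, linear (f j : K -> F^o)) ->
  dual_mon (bcop HK HL coact) Hone (fun j => dualK HL (f j)) m =
  dualK HL (dual_mon (cop HK) (cou HK) f m).
Proof.
move=> lf; rewrite -dual_prod_dualK => [|j]; last exact: dual_pow_linear.
by congr dual_prod; apply/funext => j; exact: dual_pow_dualK.
Qed.

Lemma dual_exp_dualL c g : linear (g : L -> F^o) ->
  summable (dual_pow (cop HL) (cou HL) g) ->
  dual_exp (bcop HK HL coact) Hone c (dualL HK g) =
  dualL HK (dual_exp (cop HL) (cou HL) c g).
Proof.
move=> lg sg; apply/funext => h; rewrite /dual_exp.
have -> : dual_pow (bcop HK HL coact) Hone (dualL HK g) =
    fun n => dualL HK (dual_pow (cop HL) (cou HL) g n).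
  by apply/funext => n; exact: dual_pow_dualL.
symmetry; rewrite /dualL.
(* The tensor [h] is a finite sum, so evaluation at [h] commutes with the series, with the values of
   the counit of [K] as weights. *)
transitivity (\sum_(p <- repr h) formal_series (fun n => c ^+ n / n`!%:R)
    (dual_pow (cop HL) (cou HL) g) p.2 * cou HK p.1).
  by apply: eq_bigr => p _; rewrite mulrC.
rewrite (formal_series_sum _ _ _ _ h sg); apply: eq_fsbigr => n _.
by congr (_ * _); apply: eq_bigr => p _; rewrite mulrC.
Qed.

Lemma dual_mulKL f g : linear (f : K -> F^o) -> linear (g : L -> F^o) ->
  Hmul (dualK HL f) (dualL HK g) = bidual f g.
Proof.
by move=> lf lg; rewrite bidual_mulKL ?dual_mul1r//; exact: cou_linear.
Qed.

Lemma bmul_tens k l (h' : H) : bmul HK act (k ⊗ l) h' =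
  \swd_(k', l' <- h') \swd_(k1, k2 <- cop HK k')
    ((k * k1) ⊗ (act l k2 * l')).
Proof.
rewrite /bmul tlift_tens//; split=> [y|x].
  apply: linear_tlift_param => k' l'; apply: linear_tlift_param => k1 k2.
  apply: (@linear_comp _ _ _ _ (fun x => x ⊗ _)); first exact: (tens_bilinear _ _).1.
  by move=> c u v; rewrite mulrDl scalerAl.
apply: linear_tlift_param => k' l'; apply: linear_tlift_param => k1 k2.
apply: (@linear_comp _ _ _ _ (fun y => _ ⊗ y)); first exact: (tens_bilinear _ _).2.
by move=> c u v; rewrite (act_bilinear hact).1 mulrDl scalerAl.
Qed.

(** The coproduct of 1 is [1 ⊗ 1] and 1 acts trivially, so the twist in the product disappears. *)
Lemma bmul_inL (h : H) l : bmul HK act h (inL K l) =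
  \swd_(k, l' <- h) (k ⊗ (l' * l)).
Proof.
apply: eq_tlift => k l0; rewrite tlift_tens.
  rewrite (cop1 hK) tlift_tens ?mulr1 ?(act1 hact)//; split=> [y|x].
    apply: (@linear_comp _ _ _ _ (fun x => x ⊗ _)); first exact: (tens_bilinear _ _).1.
    by move=> c u v; rewrite mulrDr scalerAr.
  apply: (@linear_comp _ _ _ _ (fun y => _ ⊗ y)); first exact: (tens_bilinear _ _).2.
  by move=> c u v; rewrite (act_bilinear hact).2 mulrDl scalerAl.
split=> [y|x]; last first.
  apply: linear_tlift_param => k1 k2.
  apply: (@linear_comp _ _ _ _ (fun y => _ ⊗ y)); first exact: (tens_bilinear _ _).2.
  by move=> c u v; rewrite mulrDr scalerAr.
apply: (@linear_comp _ _ _ _ (tlift _)); last by move=> c u v; rewrite linearP.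
apply: tlift_linear; split=> [y'|x'].
  apply: (@linear_comp _ _ _ _ (fun x => x ⊗ _)); first exact: (tens_bilinear _ _).1.
  by move=> c u v; rewrite mulrDr scalerAr.
apply: (@linear_comp _ _ _ _ (fun y => _ ⊗ y)); first exact: (tens_bilinear _ _).2.
by move=> c u v; rewrite (act_bilinear hact).2 mulrDl scalerAl.
Qed.

End BicrossproductDual.

(** * The representation induced by a character of [L] *)

Section InducedAction.
Variables (F : fieldType) (K : algType F) (L : comAlgType F).
Variables (HK : hopf_data K) (HL : hopf_data L).
Variables (act : L -> K -> L) (coact : {linear K -> tensor L K}).
Hypothesis bicross : is_bicrossproduct HK HL act coact.
Variable chi : {lrmorphism L -> F^o}.

Local Notation H := (tensor K L).
Local Notation p := (dualL HK chi).
Implicit Types ka : {linear K -> F^o}.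

Let hK := bicross_hopfK bicross.
Let hact := bicross_act bicross.

Lemma fun_linear (V W : lmodType F) (f : {linear V -> W}) : linear f.
Proof. by move=> c x y; rewrite linearP. Qed.

Let lchi : linear (chi : L -> F^o).
Proof. by move=> c x y; rewrite linearP. Qed.

Lemma times_psiE ka : times_psi HK HL coact p ka = bidual ka chi.
Proof. exact: (dual_mulKL bicross (fun_linear ka) lchi). Qed.

(** Evaluation at [k ⊗ 1] recovers [ka k], as [chi] maps 1 to 1. *)
Lemma bidual_inj : injective (fun ka => bidual ka chi).
Proof.
move=> ka ka' /(congr1 (fun f : H -> F => fun k => f (k ⊗ 1))) E.
apply: linear_eq; apply/funext => k; have := congr1 (fun f => f k) E.
have lk := fun_linear ka; have lk' := fun_linear ka'.
by rewrite !bidual_tens// rmorph1 !mulr1.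
Qed.

Lemma times_psi_bij :
  set_bij [set: {linear K -> F^o}] (induced_space HK act chi)
    (times_psi HK HL coact p).
Proof.
split=> [ka _|ka ka' _ _|f [lf fM]].
- have lk := fun_linear ka.
  rewrite times_psiE; split; first exact: bidual_linear.
  move=> h l; rewrite (bmul_inL bicross).
  rewrite [LHS](linear_tlift _ _ (bidual_linear lk lchi)) -tliftMr.
  apply: (@eq_tlift _ K L F^o) => k l'.
  by rewrite bidual_tens// rmorphM mulrA.
- by rewrite !times_psiE => /bidual_inj.
(* Surjectivity: since [k ⊗ l] is the product of [k ⊗ 1] and [l], equivariance determines [f] from
   its restriction to [K], which is the preimage. *)
have lf1 : linear (fun k => f (k ⊗ 1) : F^o).
  exact: (linear_comp lf ((tens_bilinear _ _).1 1)).
exists (pack_linear lf1) => //; rewrite times_psiE; apply/funext => h.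
rewrite -[in RHS](tlift_id h) (linear_tlift _ _ lf).
apply: (@eq_tlift _ K L F^o) => k l /=; rewrite -fM; congr f.
rewrite (bmul_inL bicross) tlift_tens ?mul1r//.
split=> [y|x]; first exact: (tens_bilinear _ _).1.
apply: (linear_comp ((tens_bilinear _ _).2 x)) => c u v.
by rewrite mulrDl scalerAl.
Qed.

(** Injectivity makes the element selected by [xget] unique, so any solution of the defining
    equation is the value. *)
Lemma induced_actE ka ka' h :
  bidual ka' chi = right_act HK act (bidual ka chi) h ->
  induced_act HK HL act coact p ka h = ka'.
Proof.
move=> E; apply: xget_unique; first by rewrite /= !times_psiE.
by move=> ka'' /=; rewrite !times_psiE -E; exact: bidual_inj.
Qed.

(** In the product of [k ⊗ 1] and [k' ⊗ l], the second leg of [k'] acts on 1 through the counit,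
    leaving [(k * k') ⊗ l]. *)
Lemma induced_act_inK ka k :
  induced_act HK HL act coact p ka (inK L k) = regular_act ka k :> (K -> F).
Proof.
have lk := fun_linear ka.
have lr : linear (regular_act ka k : K -> F^o).
  by move=> c x y; rewrite /regular_act mulrDr -scalerAr linearP.
rewrite (@induced_actE ka (pack_linear lr))//; apply/funext => h.
rewrite /right_act (bmul_tens bicross).
rewrite (linear_tlift _ _ (bidual_linear lk lchi)).
apply: (@eq_tlift _ K L F^o) => k' l /=.
rewrite (linear_tlift _ _ (bidual_linear lk lchi)) /regular_act.
rewrite -[in LHS](cou_right hK k').
have lm : linear (fun x => ka (k * x) : F^o) := lr.
rewrite (linear_tlift _ _ lm) -tliftMr; apply: (@eq_tlift _ K K F^o) => k1 k2.
rewrite bidual_tens// (act_unit hact) mulr_algl linearZ (linear_mapZ lm) /=.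
by rewrite mulrCA mulrA.
Qed.

(** The product of [1 ⊗ l] and [k' ⊗ l'] is the Sweedler sum of [k1 ⊗ (act l k2 * l')], and
    multiplicativity of [chi] splits off the factor [chi l']. *)
Lemma induced_act_inL ka l :
  induced_act HK HL act coact p ka (inL K l) =
  dual_mul (cop HK) ka (fun k => chi (act l k)) :> (K -> F).
Proof.
have lk := fun_linear ka.
have la : linear (fun k => chi (act l k) : F^o).
  exact: (linear_comp lchi ((act_bilinear hact).2 l)).
have lr := dual_mul_linear HK lk la.
rewrite (@induced_actE ka (pack_linear lr))//; apply/funext => h.
rewrite /right_act (bmul_tens bicross).
rewrite (linear_tlift _ _ (bidual_linear lk lchi)).
apply: (@eq_tlift _ K L F^o) => k' l' /=.
rewrite (linear_tlift _ _ (bidual_linear lk lchi)) /dual_mul -tliftMr.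
apply: (@eq_tlift _ K K F^o) => k1 k2.
by rewrite bidual_tens// mul1r rmorphM mulrA.
Qed.

End InducedAction.

(** * The pairing on each factor, and [psi] as a character *)

Section PsiCharacter.
Variables (F : fieldType) (K : algType F) (L : comAlgType F).
Variables (HK : hopf_data K) (HL : hopf_data L).
Variables (act : L -> K -> L) (coact : {linear K -> tensor L K}).
Hypothesis bicross : is_bicrossproduct HK HL act coact.
Hypothesis F0 : [pchar F] =i pred0.
Variables (r s : nat) (k : 'I_r -> K) (l : 'I_s -> L).
Hypothesis l_basis : is_basis (monomial l).
Variables (kappa : 'I_r -> {linear K -> F^o}) (lambda : 'I_s -> {linear L -> F^o}).
Hypothesis pairing : forall (m m' : {ffun 'I_r -> nat}) (n n' : {ffun 'I_s -> nat}),
  dual_mul (bcop HK HL coact)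
    (dual_mon (bcop HK HL coact) (bcou HK HL)
       (fun i => dualK HL (kappa i)) m')
    (dual_mon (bcop HK HL coact) (bcou HK HL)
       (fun j => dualL HK (lambda j)) n')
    (monomial k m ⊗ monomial l n) =
  if (m == m') && (n == n') then (mfact m * mfact n)%:R else 0.

Let hK := bicross_hopfK bicross.
Let hL := bicross_hopfL bicross.
Let lkappa i : linear (kappa i : K -> F^o). Proof. exact: fun_linear. Qed.
Let llambda j : linear (lambda j : L -> F^o). Proof. exact: fun_linear. Qed.

Lemma pairing_split m m' n n' :
  dual_mon (cop HK) (cou HK) kappa m' (monomial k m) *
  dual_mon (cop HL) (cou HL) lambda n' (monomial l n) =
  if (m == m') && (n == n') then (mfact m * mfact n)%:R else 0.
Proof.
rewrite -pairing (dual_mon_dualL bicross _ llambda) (dual_mon_dualK bicross _ lkappa).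
have lm := dual_mon_linear HK lkappa m'; have ln := dual_mon_linear HL llambda n'.
by rewrite (dual_mulKL bicross)// bidual_tens.
Qed.

Lemma monomial0 (A : algType F) n (g : 'I_n -> A) : monomial g [ffun=> 0%N] = 1.
Proof. by rewrite /monomial big1// => i _; rewrite ffunE expr0. Qed.

Lemma mfact0 n : mfact ([ffun=> 0%N] : {ffun 'I_n -> nat}) = 1%N.
Proof. by rewrite /mfact big1// => i _; rewrite ffunE. Qed.

(** In the split pairing, the zero multi-indices on the [L] side contribute the counit evaluated at
    1. *)
Lemma kappa_dual m' m :
  dual_mon (cop HK) (cou HK) kappa m' (monomial k m) = (m' == m)%:R * (mfact m)%:R.
Proof.
have := pairing_split m m' [ffun=> 0%N] [ffun=> 0%N].
rewrite (dual_mon0 hL llambda) monomial0 (cou1 hL) mulr1 => ->.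
rewrite eqxx andbT mfact0 muln1 eq_sym.
by case: eqP; rewrite ?mul1r ?mul0r.
Qed.

Lemma lambda_dual n' n :
  dual_mon (cop HL) (cou HL) lambda n' (monomial l n) = (n' == n)%:R * (mfact n)%:R.
Proof.
have := pairing_split [ffun=> 0%N] [ffun=> 0%N] n n'.
rewrite (dual_mon0 hK lkappa) monomial0 (cou1 hK) mul1r => ->.
rewrite eqxx mfact0 mul1n eq_sym.
by case: eqP; rewrite ?mul1r ?mul0r.
Qed.

(** All the exponentials lie in the dual of [L]; their product there agrees with [chi] on the basis
    of monomials. *)
Lemma psi_character (a : 'I_s -> F) (chi : {lrmorphism L -> F^o}) :
  (forall n : {ffun 'I_s -> nat}, chi (monomial l n) = \prod_j a j ^+ n j) ->
  psi HK HL coact lambda a = dualL HK chi.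
Proof.
move=> chi_l.
have ldexp j := dual_exp_linear hL l_basis llambda lambda_dual a j.
have -> : psi HK HL coact lambda a = dualL HK
    (dual_prod (cop HL) (cou HL) (fun j => dual_exp (cop HL) (cou HL) (a j) (lambda j))).
  rewrite -(dual_prod_dualL bicross ldexp); congr dual_prod; apply/funext => j.
  rewrite (dual_exp_dualL bicross _ (llambda j))//.
  exact: (dual_pow_summable hL l_basis llambda lambda_dual).
congr dualL; apply: (linear_basis (W := F^o) l_basis).
- exact: dual_big_linear.
- exact: fun_linear.
- move=> n; rewrite chi_l.
  exact: (dual_prod_exp_basis hL F0 l_basis llambda lambda_dual).
Qed.

End PsiCharacter.

(** * Taylor coefficients along compositions of local flows *)

Section FlowTaylor.
Variables (R : realType) (r s : nat) (L : comAlgType R[i]).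
Variables (l : 'I_s -> L).
Hypothesis l_basis : is_basis (monomial l).
Variable ltilde : forall x : 'rV[R]_s, {lrmorphism L -> R[i]^o}.
Hypothesis ltilde_l : forall x j, ltilde x (l j) = (x 0 j)%:C.
Variables (X : 'I_r -> 'rV[R]_s -> 'rV[R]_s) (der : 'I_r -> L -> L).
Hypothesis X_induced : forall i g x,
  cderive (X i x) (fun y => ltilde y g) x = ltilde x (der i g).
Variable Phi : 'I_r -> R -> 'rV[R]_s -> 'rV[R]_s.
Hypothesis Phi_flow : forall i, is_local_flow (X i) (Phi i).

Lemma ltilde_monomial x n :
  ltilde x (monomial l n) = \prod_(j < s) (x 0 j)%:C ^+ n j.
Proof.
rewrite /monomial rmorph_prod; apply: eq_bigr => j _.
by rewrite rmorphXn /= ltilde_l.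
Qed.

Lemma differentiable_monomial (n : {ffun 'I_s -> nat}) (x : 'rV[R]_s) :
  differentiable (fun y : 'rV[R]_s => \prod_(j < s) y 0 j ^+ n j) x.
Proof.
elim: (index_enum _) => [|j q IHq].
  by under eq_fun do rewrite big_nil; exact: differentiable_cst.
under eq_fun do rewrite big_cons; apply: differentiableM => //.
elim: (n j) => [|d IHd].
  by under eq_fun do rewrite expr0; exact: differentiable_cst.
under eq_fun do rewrite exprS; apply: differentiableM => //.
exact: differentiable_coord.
Qed.

Lemma ltilde_expand g : exists (q : seq {ffun 'I_s -> nat}) (c : _ -> R[i]),
  forall y, ltilde y g = \sum_(n <- q) c n * (\prod_(j < s) y 0 j ^+ n j)%:C.
Proof.
have [q [c ->]] := l_basis.2 g; exists q, c => y.
rewrite rmorph_sum; apply: eq_bigr => n _ /=.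
rewrite linearZ /= ltilde_monomial rmorph_prod; congr (_ * _).
by apply: eq_bigr => j _; rewrite rmorphXn.
Qed.

Lemma differentiable_big (I : Type) (q : seq I) (c : I -> R)
    (f : I -> 'rV[R]_s -> R) x : (forall i, differentiable (f i) x) ->
  differentiable (fun y => \sum_(i <- q) c i * f i y) x.
Proof.
move=> df; elim: q => [|i q IHq].
  by under eq_fun do rewrite big_nil; exact: differentiable_cst.
under eq_fun do rewrite big_cons; apply: differentiableD => //.
by apply: differentiableM => //; exact: differentiable_cst.
Qed.

(** As a function of the point, [ltilde y g] is a polynomial with complex coefficients in the real
    coordinates. *)
Lemma differentiable_ltilde g x :
  differentiable (fun y => complex.Re (ltilde y g)) x /\
  differentiable (fun y => complex.Im (ltilde y g)) x.
Proof.
have [q [c gE]] := ltilde_expand g.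
have E y : ltilde y g = (\sum_(n <- q) complex.Re (c n) * \prod_(j < s) y 0 j ^+ n j)
    +i* (\sum_(n <- q) complex.Im (c n) * \prod_(j < s) y 0 j ^+ n j).
  rewrite gE; elim: q {gE} => [|n q IHq]; first by rewrite !big_nil.
  rewrite !big_cons IHq; case: (c n) => u v /=.
  by apply/eqP; rewrite eq_complex /= !mulr0 subr0 add0r !eqxx.
split; under eq_fun do rewrite E /=.
  by apply: differentiable_big => n; exact: differentiable_monomial.
by apply: differentiable_big => n; exact: differentiable_monomial.
Qed.

(** Both difference quotients are the same function of [h]. This reduces partial derivatives to
    derivatives in the flow time. *)
Lemma derive_line (V W : normedModType R) (f : V -> W) (x v : V) :
  'D_v f x = 'D_1 (fun u : R => f (u *: v + x)) 0.
Proof.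
rewrite /derive; set d := (X in fmap X _); set d' := (X in _ = lim (fmap X _)).
suff -> : d = d' by [].
apply/funext => h.
by rewrite /d /d' /= /shift /= addr0 scale0r add0r [h *: 1]mulr1.
Qed.

(** By the group law, the derivative at time [u] is one at time 0 from the point [Phi i u y], where
    it is the derivative along [X i], that is, the effect of [der i]. Only the values of [G] on the
    line through [t] along [v] matter. *)
Lemma flow_cderive i (D : set (R * 'rV[R]_s)) (v : 'rV[R]_r) t (y : 'rV[R]_s) u
    (G : 'rV[R]_r -> R[i]) g :
  is_local_flow_on (X i) D (Phi i) -> D (u, y) ->
  (forall u', D (u', y) -> G (u' *: v + t) = ltilde (Phi i u' y) g) ->
  cderive v G (u *: v + t) = ltilde (Phi i u y) (der i g).
Proof.
move=> flow Duy GE; rewrite -X_induced /cderive.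
have opD p : D p -> \forall q \near p, D q.
  by move=> Dp; apply: open_nbhs_nbhs; split=> //; exact: flow_open flow.
(* Openness of [D] keeps both [(u' + u, y)] and [(u', Phi i u y)] in the domain for small [u'], as
   the group law requires. *)
have near_flow : \forall u' \near (0 : R),
    G (u' *: v + (u *: v + t)) = ltilde (Phi i u' (Phi i u y)) g.
  have c0 : (fun u' : R => u' + u) @ (0 : R) --> 0 + u.
    by apply: cvgD; [exact: cvg_id|exact: cvg_cst].
  rewrite add0r in c0.
  have c1 : (fun u' : R => (u' + u, y)) @ (0 : R) --> (u, y).
    apply: (@cvg_pair _ _ _ _ (nbhs u) (nbhs y)); first exact: c0.
    exact: cvg_cst.
  have c2 : (fun u' : R => (u', Phi i u y)) @ (0 : R) --> (0 : R, Phi i u y).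
    apply: (@cvg_pair _ _ _ _ (nbhs (0 : R)) (nbhs (Phi i u y))).
      exact: cvg_id.
    exact: cvg_cst.
  have d1 : \forall u' \near (0 : R), D (u' + u, y) by exact: (c1 _ (opD _ Duy)).
  have d2 : \forall u' \near (0 : R), D (u', Phi i u y).
    exact: (c2 _ (opD _ (flow_dom0 flow (Phi i u y)))).
  apply: filterS2 d1 d2 => u' D1 D2.
  by rewrite addrA -scalerDl GE// (flowD flow Duy).
have [dRe dIm] := differentiable_ltilde g (Phi i u y).
congr (_ +i* _).
  rewrite derive_line; have [_ <-] := flow_derive flow dRe.
  by apply: near_eq_derive; apply: filterS near_flow => u' ->.
rewrite derive_line; have [_ <-] := flow_derive flow dIm.
by apply: near_eq_derive; apply: filterS near_flow => u' ->.
Qed.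

Variable m : {ffun 'I_r -> nat}.

Lemma flow_iter_cderive i (D : set (R * 'rV[R]_s)) (v : 'rV[R]_r) t (y : 'rV[R]_s)
    (G : 'rV[R]_r -> R[i]) g n :
  is_local_flow_on (X i) D (Phi i) ->
  (forall u, D (u, y) -> G (u *: v + t) = ltilde (Phi i u y) g) ->
  iter n (cderive v) G t = ltilde y (iter n (der i) g).
Proof.
move=> flow GE.
(* The induction runs over all times in the domain, because differentiating once more uses values at
   nearby times. *)
have nE u : D (u, y) ->
    iter n (cderive v) G (u *: v + t) = ltilde (Phi i u y) (iter n (der i) g).
  elim: n u => [|n IHn] u Duy; first exact: GE.
  by rewrite !iterS; exact: flow_cderive flow Duy IHn.
have := nE 0 (flow_dom0 flow y).
by rewrite scale0r add0r (flow0 flow).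
Qed.

(* Only iterated one-variable derivatives occur, each taken at time 0 with the
   later flow times fixed, so no joint continuity of the local flows is
   needed. *)
Lemma taylor_flow_comp (w : seq 'I_r) g (y : 'rV[R]_r -> 'rV[R]_s)
    (t : 'rV[R]_r) : uniq w ->
  (forall t t' : 'rV[R]_r, (forall i, i \notin w -> t 0 i = t' 0 i) -> y t = y t') ->
  (forall i, i \in w -> t 0 i = 0) ->
  foldr (fun i G => iter (m i) (cderive (delta_mx 0 i)) G)
    (fun t => ltilde (flow_comp Phi w t (y t)) g) w t =
  ltilde (y t) (foldr (fun i => iter (m i) (der i)) g w).
Proof.
elim: w y t => [//|i w IHw] y t /= /andP[iw uw] yE t0.
have [D flow] := Phi_flow i.
(* The derivative in the time of the first flow is outermost; the remaining derivatives form the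
   function [G], computed by induction along the line. *)
apply: (flow_iter_cderive _ flow) => u _.
have tE i' : (u *: delta_mx 0 i + t) 0 i' = u * (i' == i)%:R + t 0 i'.
  by rewrite !mxE eqxx.
(* The first flow is absorbed into the starting point of the others, which still does not depend on
   their times. *)
pose y' (t : 'rV[R]_r) := Phi i (t 0 i) (y t).
rewrite -[LHS]/(foldr _ (fun t => ltilde (flow_comp Phi w t (y' t)) g) w _).
rewrite IHw//; last first.
- move=> i' i'w; rewrite tE t0 ?inE ?i'w ?orbT// addr0.
  by case: eqP i'w iw => [->->//|]; rewrite mulr0.
- move=> t1 t2 t12; rewrite /y' t12// (yE t1 t2)// => i'.
  by rewrite inE negb_or => /andP[_]; exact: t12.
rewrite /y' tE eqxx mulr1 t0 ?mem_head// addr0 (yE _ t)// => i'.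
by rewrite inE negb_or tE => /andP[/negPf -> _]; rewrite mulr0 add0r.
Qed.

Lemma taylor_coef_flow (w : seq 'I_r) g a : uniq w ->
  taylor_coef w (fun t => ltilde (flow_comp Phi w t a) g) m * (mfact m)%:R =
  ltilde a (foldr (fun i => iter (m i) (der i)) g w).
Proof.
move=> uw; rewrite /taylor_coef divfK; last by apply: mfact_neq0; exact: pchar_num.
by rewrite (@taylor_flow_comp w g (fun=> a))// => i _; rewrite mxE.
Qed.

End FlowTaylor.

(** * Iterated action of the generators and ordered monomials *)

Section ActionOrder.
Variables (F : fieldType) (K : algType F) (L : comAlgType F).
Variables (HK : hopf_data K) (act : L -> K -> L).
Hypothesis hact : is_module_algebra HK act.
Variables (r : nat) (k : 'I_r -> K) (m : {ffun 'I_r -> nat}).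

Let step i := iter (m i) (fun g => act g (k i)).

Lemma act_expr g i n : act g (k i ^+ n) = iter n (fun g => act g (k i)) g.
Proof.
elim: n => [|n IHn]; first by rewrite (act1 hact).
by rewrite exprSr (actM hact) IHn.
Qed.

Lemma foldl_act (q : seq 'I_r) g :
  foldl (fun g i => step i g) g q = act g (\prod_(i <- q) k i ^+ m i).
Proof.
elim: q g => [|i q IHq] g /=; first by rewrite big_nil (act1 hact).
by rewrite big_cons (actM hact) IHq act_expr.
Qed.

(** For a right action the leftmost factor acts first, whereas [foldr] applies the last entry first;
    hence the reversed list. *)
Lemma act_monomial g :
  foldr step g (rev (enum 'I_r)) = act g (monomial k m).
Proof. by rewrite -foldl_rev revK foldl_act /monomial [index_enum _]unlock -enumT. Qed.

Lemma act_monomial_comm g :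
  (forall i i' g, act (act g (k i)) (k i') = act (act g (k i')) (k i)) ->
  foldr step g (enum 'I_r) = act g (monomial k m).
Proof.
move=> kC.
(* Commutation extends from single actions to their iterates. *)
have iterC i i' n n' h : iter n (fun g => act g (k i)) (iter n' (fun g => act g (k i')) h)
    = iter n' (fun g => act g (k i')) (iter n (fun g => act g (k i)) h).
  have C1 n0 h0 : act (iter n0 (fun g => act g (k i')) h0) (k i)
      = iter n0 (fun g => act g (k i')) (act h0 (k i)).
    by elim: n0 => //= n0 <-.
  by elim: n => //= n ->; exact: C1.
rewrite -act_monomial -[RHS]foldl_rev revK; elim: (enum _) g => //= i q IHq g.
(* The step for [i] is moved past all the steps in [q]. *)
by rewrite -IHq; elim: q {IHq} => //= i' q <-; exact: iterC.
Qed.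

End ActionOrder.

(** * Identification of a functional with its flow series *)

Section FlowSeries.
Variables (R : realType) (K : algType R[i]) (HK : hopf_data K).
Variables (r s : nat) (k : 'I_r -> K) (kappa : 'I_r -> {linear K -> R[i]^o}).
Hypothesis k_basis : is_basis (monomial k).
Hypothesis kappa_dual : forall m' m,
  dual_mon (cop HK) (cou HK) kappa m' (monomial k m) = (m' == m)%:R * (mfact m)%:R.

(** At [monomial k m] only the [m]-th term of the series survives, with [mfact m] as the value of
    its dual monomial; the basis then determines the functional. *)
Lemma flow_series_eq (Phi : 'I_r -> R -> 'rV[R]_s -> 'rV[R]_s) (w : seq 'I_r)
    (f : 'rV[R]_s -> R[i]) (a : 'rV[R]_s) (F : K -> R[i]) :
  linear (F : K -> R[i]^o) ->
  (forall m, taylor_coef w (fun t => f (flow_comp Phi w t a)) m * (mfact m)%:R =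
     F (monomial k m)) ->
  flow_series HK kappa Phi w f a = F.
Proof.
move=> lF Fm; have lkappa i := fun_linear (kappa i).
apply: (linear_basis (W := R[i]^o) k_basis _ lF) => [|m].
  apply: formal_series_linear; last exact: dual_mon_linear.
  exact: (dual_mon_summable k_basis lkappa kappa_dual).
rewrite /flow_series (@formal_series1 _ _ _ _ _ _ m) => [|m' mm'].
  by rewrite kappa_dual eqxx mul1r Fm.
by rewrite kappa_dual (negPf mm') mul0r mulr0.
Qed.

End FlowSeries.

(** * The explicit action, for both orders of the flows *)

Unset Implicit Arguments.
Set Strict Implicit.

Theorem theorem3p2 (R : realType) (r s : nat)
  (K : algType R[i]) (L : comAlgType R[i])
  (HK : hopf_data K) (HL : hopf_data L)
  (act : L -> K -> L) (coact : {linear K -> tensor L K})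
  (bicross : is_bicrossproduct HK HL act coact)
  (cocomm : cocommutative HK)
  (k : 'I_r -> K) (l : 'I_s -> L)
  (k_primitive : forall i, primitive HK (k i))
  (k_basis : is_basis (monomial k))
  (l_basis : is_basis (monomial l))
  (kappa : 'I_r -> {linear K -> R[i]^o}) (lambda : 'I_s -> {linear L -> R[i]^o})
  (pairing : forall (m m' : {ffun 'I_r -> nat}) (n n' : {ffun 'I_s -> nat}),
     dual_mul (bcop HK HL coact)
       (dual_mon (bcop HK HL coact) (bcou HK HL)
          (fun i => dualK HL (kappa i)) m')
       (dual_mon (bcop HK HL coact) (bcou HK HL)
          (fun j => dualL HK (lambda j)) n')
       (monomial k m ⊗ monomial l n) =
     if (m == m') && (n == n') then (mfact m * mfact n)%:R else 0)
  (ltilde : forall x : 'rV[R]_s, {lrmorphism L -> R[i]^o})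
  (ltilde_l : forall x j, ltilde x (l j) = (x 0 j)%:C)
  (X : 'I_r -> 'rV[R]_s -> 'rV[R]_s)
  (X_induced : forall i g x,
     cderive (X i x) (fun y => ltilde y g) x = ltilde x (act g (k i)))
  (Phi : 'I_r -> R -> 'rV[R]_s -> 'rV[R]_s)
  (Phi_flow : forall i, is_local_flow (X i) (Phi i))
  (a : 'rV[R]_s)
  (chi : {lrmorphism L -> R[i]^o})
  (chi_l : forall n : {ffun 'I_s -> nat},
     chi (monomial l n) = \prod_(j < s) (a 0 j)%:C ^+ n j) :
  let p := psi HK HL coact lambda (fun j => (a 0 j)%:C) in
  [/\ set_bij [set: {linear K -> R[i]^o}] (induced_space HK act chi)
        (times_psi HK HL coact p),
      forall (ka : {linear K -> R[i]^o}) (i : 'I_r),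
        induced_act HK HL act coact p ka (inK L (k i)) = regular_act ka (k i)
          :> (K -> R[i]),
      forall (ka : {linear K -> R[i]^o}) (j : 'I_s),
        induced_act HK HL act coact p ka (inL K (l j)) =
        dual_mul (cop HK) ka
          (flow_series HK kappa Phi (rev (enum 'I_r))
             (fun x => ltilde x (l j)) a)
          :> (K -> R[i]) &
      (forall i i' g, act (act g (k i)) (k i') = act (act g (k i')) (k i)) ->
      forall (ka : {linear K -> R[i]^o}) (j : 'I_s),
        induced_act HK HL act coact p ka (inL K (l j)) =
        dual_mul (cop HK) ka
          (flow_series HK kappa Phi (enum 'I_r)
             (fun x => ltilde x (l j)) a)
          :> (K -> R[i])].
Proof.
move=> p; have F0 := @pchar_num R[i].
have pE : p = dualL HK chi.
  exact: (psi_character bicross F0 l_basis pairing chi_l).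
have kappaE := kappa_dual bicross pairing.
(* Evaluation at [a] and the character take the same values on the monomial basis. *)
have ltildeE : ltilde a = chi :> (L -> R[i]).
  apply: (linear_basis (W := R[i]^o) l_basis) => [||n]; try exact: fun_linear.
  by rewrite chi_l (ltilde_monomial ltilde_l).
(* For any order [w] of the flows, what remains is to compare the iterated action along [w] with
   that of the ordered monomials. *)
have flowE w j : uniq w ->
    (forall m : {ffun 'I_r -> nat}, foldr (fun i => iter (m i) (fun g => act g (k i)))
       (l j) w = act (l j) (monomial k m)) ->
    flow_series HK kappa Phi w (fun x => ltilde x (l j)) a =
    (fun g => chi (act (l j) g)).
  move=> uw wE; apply: (flow_series_eq k_basis kappaE) => [|m].
    apply: (linear_comp (fun_linear chi)).
    exact: (act_bilinear (bicross_act bicross)).2.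
  rewrite (taylor_coef_flow l_basis ltilde_l X_induced Phi_flow)//.
  by rewrite wE ltildeE.
rewrite pE; split.
- exact: times_psi_bij.
- move=> ka i; exact: (induced_act_inK bicross).
(* The decreasing list, with the flow of the last index applied first, matches the ordered monomials
   in general. *)
- move=> ka j; rewrite (induced_act_inL bicross) flowE ?rev_uniq ?enum_uniq// => m.
  exact: (act_monomial (bicross_act bicross)).
(* When the actions of the generators commute, the increasing list, with the flow of the first index
   applied first, gives the same coefficients. *)
- move=> kC ka j; rewrite (induced_act_inL bicross) flowE ?enum_uniq// => m.
  exact: (act_monomial_comm (bicross_act bicross)).
Qed.
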